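(* Let $n\ge 1$. Every balanced stack of $n$ blocks has overhang at most $6n^{1/3}$.
   Context: Two-dimensional model. The table is the region $B_0=(-\infty,0]\times(-\infty,0]$. Each block $B_i$ ($1\le i\le n$) is a homogeneous rectangle of length $1$, weight $1$ and a fixed height $h>0$, occupying $[x_i,x_i+1]\times[y_i,y_i+h]$; distinct blocks may touch but have disjoint interiors. Block $B_i$ rests on $B_j$ ($j\ge 1$) if $B_i\cap B_j\neq\emptyset$ and $y_i=y_j+h$; $B_i$ rests on the table if $B_i\cap B_0\ne\emptyset$. When $B_i$ rests on $B_j$, $B_j$ may exert on $B_i$ an upward vertical force $f_{ij}\ge 0$ applied at a single point of the contact segment $B_i\cap B_j$, and $B_i$ exerts the equal opposite force on $B_j$; there is no friction, so all forces are vertical. Each block also receives a downward gravitational force of magnitude $1$ at its center $(x_i+\tfrac12, y_i+\tfrac h2)$. A block is in equilibrium if the total upward force it receives from below equals $1$ plus the total upward force it exerts on blocks above it, and the corresponding moments (sum of position times magnitude) balance, the gravitational force acting at horizontal position $x_i+\frac12$. A stack is balanced if there is a choice of such forces under which every block is in equilibrium. The overhang of the stack is $\max_{1\le i\le n}(x_i+1)$. *)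

(* Defs.v *)
From Stdlib Require Import Reals.
Open Scope R_scope.

(* A stack of n blocks: block i (1 <= i <= n) occupies
   [x i, x i + 1] x [y i, y i + h].  Index 0 denotes the table
   B_0 = (-oo,0] x (-oo,0]. *)

Definition in_B (x y : nat -> R) (h : R) (i : nat) (a b : R) : Prop :=
  match i with
  | O => a <= 0 /\ b <= 0
  | _ => x i <= a <= x i + 1 /\ y i <= b <= y i + h
  end.

Definition in_int_B (x y : nat -> R) (h : R) (i : nat) (a b : R) : Prop :=
  match i with
  | O => a < 0 /\ b < 0
  | _ => x i < a < x i + 1 /\ y i < b < y i + h
  end.

Definition valid_stack (n : nat) (x y : nat -> R) (h : R) : Prop :=
  forall i j, (i <= n)%nat -> (j <= n)%nat -> i <> j ->
    ~ (exists a b, in_int_B x y h i a b /\ in_int_B x y h j a b).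

Definition rests_on (n : nat) (x y : nat -> R) (h : R) (i j : nat) : Prop :=
  (1 <= i <= n)%nat /\ (j <= n)%nat /\
  (exists a b, in_B x y h i a b /\ in_B x y h j a b) /\
  (j <> O -> y i = y j + h).

Definition in_contact (x y : nat -> R) (h : R) (i j : nat) (p : R) : Prop :=
  exists b, in_B x y h i p b /\ in_B x y h j p b.

(* Balanced: there are forces f i j >= 0 (exerted upward by B_j on B_i,
   nonzero only when B_i rests on B_j), applied at horizontal positions
   p i j in the contact set, such that every block is in equilibrium
   (forces and moments). *)
Definition balanced (n : nat) (x y : nat -> R) (h : R) : Prop :=
  exists f p : nat -> nat -> R,
    (forall i j, 0 <= f i j) /\
    (forall i j, ~ rests_on n x y h i j -> f i j = 0) /\
    (forall i j, rests_on n x y h i j -> in_contact x y h i j (p i j)) /\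
    (forall i, (1 <= i <= n)%nat ->
       sum_f_R0 (fun j => f i j) n = 1 + sum_f_R0 (fun k => f k i) n /\
       sum_f_R0 (fun j => f i j * p i j) n
         = (x i + /2) + sum_f_R0 (fun k => f k i * p k i) n).

(* Main.v *)
Require Import Defs.
From Stdlib Require Import Reals Lra Lia Psatz List Arith.
From Coquelicot Require Import Coquelicot.
Open Scope R_scope.

(* Process the blocks from bottom to top: each block replaces the forces it
   receives from below by the forces it exerts above plus its own weight, a
   redistribution of mass inside a unit interval that keeps total mass and centre
   of mass.  Mass [n] on the half-line of the table thus becomes [n] unit masses at
   the block centres.  Potentials [t |-> int (z - t)^+] compare this process with
   an extremal one that sweeps all mass of an interval to its endpoints.  For
   sweeps, Cauchy-Schwarz shows that the spread [sum sum w w' |z - z'|] grows by at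
   least six times the square of the growth of the second moment; since the spread
   is controlled by the square root of the second moment, mass [L^3] at [c]
   subjected to [L^3] sweeps has variance at most [2/5 L^2].  Hence both the mass
   and the number of blocks beyond [c + O(L)] drop by a factor 8, and iterating
   with [L/2] from [c + 3 L] gives the bound [6 L], a geometric series. *)

(** * Finite weighted point masses *)

Definition wsum (phi : R -> R) (m : list (R * R)) : R :=
  fold_right (fun q s => snd q * phi (fst q) + s) 0 m.

Definition nonneg_weights (m : list (R * R)) : Prop :=
  forall q, In q m -> 0 <= snd q.

Lemma nonneg_weights_cons q m :
  nonneg_weights (q :: m) -> 0 <= snd q /\ nonneg_weights m.
Proof.
intros H; split; [apply H; now left|]. intros p Hp; apply H; now right.
Qed.

Lemma wsum_ext phi psi m : (forall x, phi x = psi x) -> wsum phi m = wsum psi m.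
Proof.
intros H; induction m as [|q m IH]; simpl; [easy|]. now rewrite IH, H.
Qed.

Lemma wsum_plus phi psi m :
  wsum (fun x => phi x + psi x) m = wsum phi m + wsum psi m.
Proof. induction m as [|q m IH]; simpl; [lra|]. rewrite IH; ring. Qed.

Lemma wsum_scal k phi m : wsum (fun x => k * phi x) m = k * wsum phi m.
Proof. induction m as [|q m IH]; simpl; [lra|]. rewrite IH; ring. Qed.

Lemma wsum_le phi psi m :
  nonneg_weights m -> (forall x, phi x <= psi x) -> wsum phi m <= wsum psi m.
Proof.
intros Hm H; induction m as [|q m IH]; simpl; [lra|].
apply nonneg_weights_cons in Hm as [Hq Hm].
apply Rplus_le_compat; [|now apply IH].
now apply Rmult_le_compat_l.
Qed.

(** * Step functions and the Brownian bridge kernel *)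

Definition step_at (z t : R) : R := if Rlt_dec t z then 1 else 0.

Lemma is_RInt_real_const (a b k v : R) :
  v = (b - a) * k -> is_RInt (fun _ => k) a b v.
Proof. intros ->. exact (is_RInt_const a b k). Qed.

Lemma is_RInt_real_plus (f g : R -> R) (a b u v : R) :
  is_RInt f a b u -> is_RInt g a b v -> is_RInt (fun t => f t + g t) a b (u + v).
Proof. exact (is_RInt_plus f g a b u v). Qed.

Lemma is_RInt_real_scal (k : R) (f : R -> R) (a b u : R) :
  is_RInt f a b u -> is_RInt (fun t => k * f t) a b (k * u).
Proof. exact (is_RInt_scal f a b k u). Qed.

Lemma is_RInt_real_ext (f g : R -> R) (a b v : R) :
  (forall t, f t = g t) -> is_RInt f a b v -> is_RInt g a b v.
Proof. intros H; apply is_RInt_ext; auto. Qed.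

Lemma is_RInt_step_at psi Psi z b :
  (forall c, 0 <= c <= 1 -> is_RInt psi 0 c (Psi c)) ->
  0 <= z <= 1 -> 0 <= b <= 1 ->
  is_RInt (fun t => step_at z t * psi t) 0 b (Psi (Rmin z b)).
Proof.
intros H Hz Hb.
assert (below : forall c, 0 <= c <= z ->
          is_RInt (fun t => step_at z t * psi t) 0 c (Psi c)).
{ intros c Hc. apply (is_RInt_ext psi); [|apply H; lra].
  intros t Ht. rewrite Rmax_right in Ht by lra.
  unfold step_at; destruct (Rlt_dec t z); lra. }
unfold Rmin; destruct (Rle_dec z b) as [zb|zb]; [|apply below; lra].
replace (Psi z) with (plus (Psi z) 0) by (unfold plus; simpl; ring).
apply is_RInt_Chasles with z; [apply below; lra|].
apply (is_RInt_ext (fun _ => 0)).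
- intros t Ht. rewrite Rmin_left in Ht by lra.
  unfold step_at; destruct (Rlt_dec t z); lra.
- apply is_RInt_real_const; ring.
Qed.

(** General in [psi] so that it can be fed its own output: [psi = 1] gives the primitive of a sum of
    steps, and taking that sum as [psi] then gives the integral of its square as a double sum of
    minima. *)
Lemma is_RInt_wsum_step_at psi Psi (z : R -> R) m b :
  (forall c, 0 <= c <= 1 -> is_RInt psi 0 c (Psi c)) ->
  (forall x, 0 <= z x <= 1) -> 0 <= b <= 1 ->
  is_RInt (fun t => wsum (fun x => step_at (z x) t) m * psi t) 0 b
    (wsum (fun x => Psi (Rmin (z x) b)) m).
Proof.
intros H Hz Hb; induction m as [|q m IH]; simpl.
- apply (is_RInt_real_ext (fun _ => 0)); [intros t; ring|].
  apply is_RInt_real_const; ring.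
- apply (is_RInt_real_ext (fun t => snd q * (step_at (z (fst q)) t * psi t) +
           wsum (fun x => step_at (z x) t) m * psi t)).
  { intros t; ring. }
  apply is_RInt_real_plus; [|exact IH]. apply is_RInt_real_scal.
  now apply is_RInt_step_at.
Qed.

Lemma is_RInt_id c : is_RInt (fun t => t) 0 c (c ^ 2 / 2).
Proof.
evar_last.
- apply (is_RInt_derive (fun t => t ^ 2 / 2) (fun t => t)).
  + intros t _. auto_derive; [easy|]. field.
  + intros t _. apply continuous_id.
- unfold minus, plus, opp; simpl; field.
Qed.

(* [min x y - x y] is the covariance of the Brownian bridge; the inequality says
   that [sum w (1_{t<z} - z) - 6 l (1/2 - t)] has a nonnegative L^2 norm. *)
Lemma bridge_kernel_lower_bound (z : R -> R) m l :
  (forall x, 0 <= z x <= 1) ->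
  6 * l * wsum (fun x => z x * (1 - z x)) m - 3 * l ^ 2 <=
  wsum (fun x => wsum (fun y => Rmin (z x) (z y) - z x * z y) m) m.
Proof.
intros Hz.
set (G := fun t => wsum (fun x => step_at (z x) t) m).
set (Z1 := wsum z m). set (Z2 := wsum (fun x => z x ^ 2) m).
set (K := wsum (fun x => wsum (fun y => Rmin (z x) (z y)) m) m).
assert (I1 : forall c, 0 <= c <= 1 ->
          is_RInt G 0 c (wsum (fun x => Rmin (z x) c) m)).
{ intros c Hc. apply (is_RInt_real_ext (fun t => G t * 1)); [intros t; ring|].
  apply (is_RInt_wsum_step_at (fun _ => 1) (fun c => c)); auto.
  intros d Hd. apply is_RInt_real_const; ring. }
assert (min1 : forall x, Rmin (z x) 1 = z x) by (intros; apply Rmin_left, Hz).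
assert (IG : is_RInt G 0 1 Z1).
{ evar_last; [apply I1; lra|]. now apply wsum_ext. }
assert (IGt : is_RInt (fun t => G t * t) 0 1 (Z2 / 2)).
{ evar_last; [apply (is_RInt_wsum_step_at (fun t => t) (fun c => c ^ 2 / 2)); auto; [|lra]|].
  - intros; apply is_RInt_id.
  - unfold Z2, Rdiv. rewrite (Rmult_comm (wsum _ _)), <- wsum_scal.
    apply wsum_ext; intros x. rewrite min1. simpl; field. }
assert (IGG : is_RInt (fun t => G t * G t) 0 1 K).
{ evar_last; [apply (is_RInt_wsum_step_at _ _ z m 1 I1); auto; lra|].
  apply wsum_ext; intros x. rewrite min1. apply wsum_ext; intros y. apply Rmin_comm. }
(* The function subtracted from [G]: the mean [Z1] of [G] plus a multiple of [1/2 - t], whose inner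
   product with [G] is [(Z1 - Z2) / 2]. *)
assert (Iq : is_RInt (fun t => (6 * l * (1 / 2 - t) + Z1) ^ 2) 0 1 (3 * l ^ 2 + Z1 ^ 2)).
{ evar_last.
  - apply (is_RInt_derive (fun t => 36 * l ^ 2 * (t / 4 - t ^ 2 / 2 + t ^ 3 / 3)
        + 12 * l * Z1 * (t / 2 - t ^ 2 / 2) + Z1 ^ 2 * t)).
    + intros t _. auto_derive; [easy|]. field.
    + intros t _. apply (@ex_derive_continuous R_AbsRing R_NormedModule). now auto_derive.
  - unfold minus, plus, opp; simpl; field. }
assert (I : is_RInt (fun t => (G t - (6 * l * (1 / 2 - t) + Z1)) ^ 2) 0 1
              (K + (- (6 * l + 2 * Z1) * Z1 + (12 * l * (Z2 / 2) + (3 * l ^ 2 + Z1 ^ 2))))).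
{ apply (is_RInt_real_ext (fun t => G t * G t + (- (6 * l + 2 * Z1) * G t +
     (12 * l * (G t * t) + (6 * l * (1 / 2 - t) + Z1) ^ 2)))).
  { intros t; field. }
  apply is_RInt_real_plus; [exact IGG|].
  apply is_RInt_real_plus; [now apply is_RInt_real_scal|].
  apply is_RInt_real_plus; [now apply is_RInt_real_scal|exact Iq]. }
assert (pos : 0 <= K + (- (6 * l + 2 * Z1) * Z1 + (12 * l * (Z2 / 2) + (3 * l ^ 2 + Z1 ^ 2)))).
{ apply (is_RInt_le (fun _ => 0) _ 0 1) with (3 := I); [lra| |].
  - apply is_RInt_real_const; ring.
  - intros t _. apply pow2_ge_0. }
assert (E1 : wsum (fun x => z x * (1 - z x)) m = Z1 - Z2).
{ rewrite (wsum_ext _ (fun x => z x + (-1) * z x ^ 2)) by (intros; ring).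
  rewrite wsum_plus, wsum_scal. unfold Z1, Z2; simpl; ring. }
assert (E2 : wsum (fun x => wsum (fun y => Rmin (z x) (z y) - z x * z y) m) m = K - Z1 ^ 2).
{ rewrite (wsum_ext _ (fun x => wsum (fun y => Rmin (z x) (z y)) m + (- Z1) * z x)).
  - rewrite wsum_plus, wsum_scal. unfold K; fold Z1; ring.
  - intros x. rewrite (wsum_ext _ (fun y => Rmin (z x) (z y) + (- z x) * z y)) by (intros; ring).
    rewrite wsum_plus, wsum_scal. fold Z1; ring. }
rewrite E1, E2. lra.
Qed.

(** * Sweeping an interval to its endpoints *)

(** The operator on test functions dual to [sweep a]; through it, statements on swept masses become
    pointwise ones. *)
Definition chord (a : R) (phi : R -> R) (x : R) : R :=
  if Rle_dec a x then
    if Rle_dec x (a + 1) then phi a * (a + 1 - x) + phi (a + 1) * (x - a)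
    else phi x
  else phi x.

Fixpoint sweep (a : R) (m : list (R * R)) : list (R * R) :=
  match m with
  | nil => nil
  | (x, w) :: m' =>
      if Rle_dec a x then
        if Rle_dec x (a + 1) then
          (a, w * (a + 1 - x)) :: (a + 1, w * (x - a)) :: sweep a m'
        else (x, w) :: sweep a m'
      else (x, w) :: sweep a m'
  end.

Lemma wsum_sweep phi a m : wsum phi (sweep a m) = wsum (chord a phi) m.
Proof.
induction m as [|[x w] m IH]; simpl; [easy|]. unfold chord at 1.
destruct (Rle_dec a x); [destruct (Rle_dec x (a + 1))|]; simpl; rewrite IH; ring.
Qed.

Lemma nonneg_weights_sweep a m : nonneg_weights m -> nonneg_weights (sweep a m).
Proof.
intros H; induction m as [|[x w] m IH]; simpl; [easy|].
apply nonneg_weights_cons in H as [Hw H]; simpl in Hw. specialize (IH H).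
destruct (Rle_dec a x); [destruct (Rle_dec x (a + 1))|];
  intros q Hq; simpl in Hq; intuition; subst; simpl; auto; apply Rmult_le_pos; lra.
Qed.

Lemma wsum_sweep_affine phi a m k b :
  (forall x, a <= x <= a + 1 -> phi x = k * x + b) ->
  wsum phi (sweep a m) = wsum phi m.
Proof.
intros H; rewrite wsum_sweep; apply wsum_ext; intros x; unfold chord.
destruct (Rle_dec a x); [destruct (Rle_dec x (a + 1))|]; auto.
rewrite !H by lra. ring.
Qed.

Lemma chord_wsum a (F : R -> R -> R) m x :
  chord a (fun s => wsum (F s) m) x = wsum (fun y => chord a (fun s => F s y) x) m.
Proof.
unfold chord; destruct (Rle_dec a x); [destruct (Rle_dec x (a + 1))|]; auto.
rewrite (Rmult_comm (wsum _ _)), (Rmult_comm (wsum (F (a + 1)) _)).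
rewrite <- !wsum_scal, <- wsum_plus. apply wsum_ext; intros; ring.
Qed.

Definition ramp (t x : R) : R := Rmax 0 (x - t).

Lemma wsum_ramp_sweep_outside a t m :
  t <= a \/ a + 1 <= t -> wsum (ramp t) (sweep a m) = wsum (ramp t) m.
Proof.
intros [H|H].
- apply wsum_sweep_affine with (k := 1) (b := - t).
  intros x Hx; unfold ramp; rewrite Rmax_right; lra.
- apply wsum_sweep_affine with (k := 0) (b := 0).
  intros x Hx; unfold ramp; rewrite Rmax_left; lra.
Qed.

(** A swept interval has no mass in its interior, so the potential is affine there, and its values
    at the two ends are those before the sweep. *)
Lemma wsum_ramp_sweep_inside a t m :
  a <= t <= a + 1 ->
  wsum (ramp t) (sweep a m) =
  (a + 1 - t) * wsum (ramp a) m + (t - a) * wsum (ramp (a + 1)) m.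
Proof.
intros H. rewrite wsum_sweep, <- !wsum_scal, <- wsum_plus.
apply wsum_ext; intros x. unfold chord, ramp, Rmax.
repeat destruct (Rle_dec _ _); lra || nra.
Qed.

Lemma ramp_nonneg t x : 0 <= ramp t x.
Proof. apply Rmax_l. Qed.

Lemma ramp_chord a t x : a <= t <= a + 1 ->
  ramp t x <= (a + 1 - t) * ramp a x + (t - a) * ramp (a + 1) x.
Proof.
intros H; unfold ramp, Rmax; repeat destruct (Rle_dec _ _); nra.
Qed.

(** * Growth of spread against second moment *)

Definition spread (m : list (R * R)) : R :=
  wsum (fun x => wsum (fun y => Rabs (x - y)) m) m.

(* Points outside [a, a + 1] get coordinate 0, where the kernel and the
   second-moment increment of [sweep a] both vanish. *)
Definition coordinate (a x : R) : R :=
  if Rle_dec a x then if Rle_dec x (a + 1) then x - a else 0 else 0.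

Lemma coordinate_bounds a x : 0 <= coordinate a x <= 1.
Proof. unfold coordinate; repeat destruct (Rle_dec _ _); lra. Qed.

(** If one point lies outside the interval, the distance is affine in the other one there and the
    kernel vanishes. For coordinates [u], [v] inside, [u + v - 2 u v] replaces
    [|u - v| = u + v - 2 min u v]. *)
Lemma chord_chord_dist a x y :
  chord a (fun s => chord a (fun u => Rabs (s - u)) y) x =
  Rabs (x - y) +
  2 * (Rmin (coordinate a x) (coordinate a y) - coordinate a x * coordinate a y).
Proof.
unfold chord, coordinate.
destruct (Rle_dec a x); [destruct (Rle_dec x (a + 1))|];
(destruct (Rle_dec a y); [destruct (Rle_dec y (a + 1))|]);
unfold Rmin; repeat destruct (Rle_dec _ _);
unfold Rabs; repeat destruct (Rcase_abs _); lra || nra.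
Qed.

Lemma spread_sweep a m :
  spread (sweep a m) = spread m + 2 *
    wsum (fun x => wsum (fun y => Rmin (coordinate a x) (coordinate a y) -
                                  coordinate a x * coordinate a y) m) m.
Proof.
unfold spread. rewrite wsum_sweep, <- wsum_scal, <- wsum_plus.
apply wsum_ext; intros x.
rewrite <- wsum_scal, <- wsum_plus.
transitivity (chord a (fun s => wsum (chord a (fun u => Rabs (s - u))) m) x).
- unfold chord at 1 2. now rewrite !wsum_sweep.
- rewrite chord_wsum. apply wsum_ext; intros y. apply chord_chord_dist.
Qed.

Lemma moment2_sweep c a m :
  wsum (fun x => (x - c) ^ 2) (sweep a m) = wsum (fun x => (x - c) ^ 2) m +
    wsum (fun x => coordinate a x * (1 - coordinate a x)) m.
Proof.
rewrite wsum_sweep, <- wsum_plus. apply wsum_ext; intros x.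
unfold chord, coordinate; repeat destruct (Rle_dec _ _); ring.
Qed.

(** Cauchy-Schwarz is kept in linearised form with a free multiplier [l], so that the estimates for
    successive sweeps add up. *)
Lemma spread_moment2_sweep l c a m :
  spread m - 12 * l * wsum (fun x => (x - c) ^ 2) m - 6 * l ^ 2 <=
  spread (sweep a m) - 12 * l * wsum (fun x => (x - c) ^ 2) (sweep a m).
Proof.
rewrite spread_sweep, (moment2_sweep c).
pose proof (bridge_kernel_lower_bound (coordinate a) m l (coordinate_bounds a)). lra.
Qed.

Lemma dist_le_AMGM e x y : 0 < e -> Rabs (x - y) <= e / 2 + (x - y) ^ 2 / (2 * e).
Proof.
intros He.
assert (H : e / 2 + (x - y) ^ 2 / (2 * e) - Rabs (x - y) = (Rabs (x - y) - e) ^ 2 / (2 * e)).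
{ rewrite <- (pow2_abs (x - y)). field. lra. }
assert (0 <= (Rabs (x - y) - e) ^ 2 / (2 * e)).
{ apply Rmult_le_pos; [apply pow2_ge_0|]. left; apply Rinv_0_lt_compat; lra. }
lra.
Qed.

(** Sum AM-GM over all pairs: when [c] is the centre of mass, the double sum of [(x - y)^2] is twice
    mass times second moment. *)
Lemma spread_le_moment2 e c m :
  0 < e -> nonneg_weights m -> wsum (fun x => x - c) m = 0 ->
  spread m <= wsum (fun _ => 1) m ^ 2 * e / 2 +
              wsum (fun _ => 1) m * wsum (fun x => (x - c) ^ 2) m / e.
Proof.
intros He Hm Hc. set (M := wsum (fun _ => 1) m). set (W := wsum _ m).
apply Rle_trans with (wsum (fun x => wsum (fun y => e / 2 + (x - y) ^ 2 / (2 * e)) m) m).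
{ apply wsum_le; auto; intros x. apply wsum_le; auto; intros y. now apply dist_le_AMGM. }
right. rewrite (wsum_ext _ (fun x => (e / 2 * M + / (2 * e) * W) * 1 +
    (/ (2 * e) * M) * (x - c) ^ 2)).
- rewrite wsum_plus, !wsum_scal. fold M; fold W. field. lra.
- intros x. rewrite (wsum_ext _ (fun y => (e / 2 + / (2 * e) * (x - c) ^ 2) * 1 +
    (/ (2 * e) * (y - c) ^ 2 + (- / e * (x - c)) * (y - c)))) by (intros; field; lra).
  rewrite !wsum_plus, !wsum_scal, Hc. fold M; fold W. field. lra.
Qed.

(** * Variance of a repeatedly swept point mass *)

Fixpoint sweeps (l : list R) (m : list (R * R)) : list (R * R) :=
  match l with nil => m | a :: l' => sweep a (sweeps l' m) end.

Lemma nonneg_weights_sweeps l m : nonneg_weights m -> nonneg_weights (sweeps l m).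
Proof. intros H; induction l; simpl; auto using nonneg_weights_sweep. Qed.

Lemma sweeps_affine l m k b :
  wsum (fun x => k * x + b) (sweeps l m) = wsum (fun x => k * x + b) m.
Proof.
induction l as [|a l IH]; simpl; auto.
rewrite <- IH. now apply wsum_sweep_affine with (k := k) (b := b).
Qed.

Lemma spread_moment2_sweeps u c l m :
  spread m - 12 * u * wsum (fun x => (x - c) ^ 2) m - 6 * u ^ 2 * INR (length l) <=
  spread (sweeps l m) - 12 * u * wsum (fun x => (x - c) ^ 2) (sweeps l m).
Proof.
induction l as [|a l IH]; simpl sweeps; simpl length; [simpl; lra|].
pose proof (spread_moment2_sweep u c a (sweeps l m)). rewrite S_INR. lra.
Qed.

Lemma moment2_sweeps_point L c l :
  0 < L -> INR (length l) <= L ^ 3 ->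
  wsum (fun x => (x - c) ^ 2) (sweeps l ((c, L ^ 3) :: nil)) <= 2 / 5 * L ^ 5.
Proof.
intros HL Hl. set (m0 := (c, L ^ 3) :: nil). set (m := sweeps l m0).
set (W := wsum _ m).
assert (HM : 0 < L ^ 3) by now apply pow_lt.
assert (Hm0 : nonneg_weights m0) by (intros q [<-|[]]; simpl; lra).
assert (mass : wsum (fun _ => 1) m = L ^ 3).
{ rewrite (wsum_ext _ (fun x => 0 * x + 1)) by (intros; ring).
  unfold m; rewrite sweeps_affine; simpl; ring. }
assert (centre : wsum (fun x => x - c) m = 0).
{ rewrite (wsum_ext _ (fun x => 1 * x + - c)) by (intros; ring).
  unfold m; rewrite sweeps_affine; simpl; ring. }
(* With this multiplier, and [e = L] in the upper bound below,
   [24/5 L^2 W <= L^7/2 + L^2 W + 24/25 L^7], so [W <= 73/190 L^5], just below [2/5 L^5]. *)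
pose proof (spread_moment2_sweeps (2 / 5 * L ^ 2) c l m0) as low.
fold m in low; fold W in low.
assert (S0 : spread m0 = 0).
{ unfold spread, m0; simpl. rewrite Rminus_diag, Rabs_R0; ring. }
assert (W0 : wsum (fun x => (x - c) ^ 2) m0 = 0) by (unfold m0; simpl; ring).
rewrite S0, W0 in low.
pose proof (spread_le_moment2 L c m HL (nonneg_weights_sweeps l m0 Hm0) centre) as up.
fold W in up; rewrite mass in up.
replace (L ^ 3 * W / L) with (L ^ 2 * W) in up by (field; lra).
assert (HL2 : 0 < L ^ 2) by now apply pow_lt.
assert (Hl' : 6 * (2 / 5 * L ^ 2) ^ 2 * INR (length l) <= 6 * (2 / 5 * L ^ 2) ^ 2 * L ^ 3).
{ apply Rmult_le_compat_l; auto. pose proof (pow2_ge_0 (2 / 5 * L ^ 2)); lra. }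
assert (HL5 : 0 < L ^ 5) by now apply pow_lt.
apply (Rmult_le_reg_l (L ^ 2)); auto.
assert (0 <= L ^ 7) by (apply pow_le; lra).
replace (6 * (2 / 5 * L ^ 2) ^ 2 * L ^ 3) with (24 / 25 * L ^ 7) in Hl' by field.
replace ((L ^ 3) ^ 2 * L / 2) with (L ^ 7 / 2) in up by field.
replace (L ^ 2 * (2 / 5 * L ^ 5)) with (2 / 5 * L ^ 7) by field.
nra.
Qed.

(** The parabola touches the line [x - c - s] at [x = c + 2 s]. *)
Lemma ramp_le_square s c x : 0 < s -> ramp (c + s) x <= / (4 * s) * (x - c) ^ 2.
Proof.
intros Hs. assert (0 < / (4 * s)) by (apply Rinv_0_lt_compat; lra).
apply Rmax_lub.
- apply Rmult_le_pos; [lra|apply pow2_ge_0].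
- apply (Rmult_le_reg_l (4 * s)); [lra|].
  rewrite <- Rmult_assoc, Rinv_r by lra. pose proof (pow2_ge_0 (x - c - 2 * s)). nra.
Qed.

Lemma wsum_ramp_sweeps_point L c l s :
  0 < L -> INR (length l) <= L ^ 3 -> 0 < s ->
  wsum (ramp (c + s)) (sweeps l ((c, L ^ 3) :: nil)) <= L ^ 5 / (10 * s).
Proof.
intros HL Hl Hs. set (m := sweeps _ _).
apply Rle_trans with (/ (4 * s) * wsum (fun x => (x - c) ^ 2) m).
- rewrite <- wsum_scal. apply wsum_le.
  + apply nonneg_weights_sweeps. intros q [<-|[]]; simpl; apply (pow_le L 3); lra.
  + intros x. now apply ramp_le_square.
- replace (L ^ 5 / (10 * s)) with (/ (4 * s) * (2 / 5 * L ^ 5)) by (field; lra).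
  apply Rmult_le_compat_l; [left; apply Rinv_0_lt_compat; lra|].
  now apply moment2_sweeps_point.
Qed.

(** * Forces as a transport of load *)

(** Positions are constrained only where the force is nonzero, since [p] is arbitrary elsewhere.
    [force_upward] makes the support relation acyclic. *)
Record force_system (n : nat) (x y : nat -> R) (f p : nat -> nat -> R) : Prop := {
  force_nonneg : forall i j, 0 <= f i j;
  force_support : forall i j, f i j <> 0 -> (1 <= i <= n)%nat /\ (j <= n)%nat;
  force_above : forall i j, f i j <> 0 -> x i <= p i j <= x i + 1;
  force_table : forall i, f i O <> 0 -> p i O <= 0;
  force_below : forall i j, j <> O -> f i j <> 0 -> x j <= p i j <= x j + 1;
  force_upward : forall i j, j <> O -> f i j <> 0 -> y j < y i;
  force_balance : forall i, (1 <= i <= n)%nat ->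
    sum_f_R0 (fun j => f i j) n = 1 + sum_f_R0 (fun k => f k i) n;
  moment_balance : forall i, (1 <= i <= n)%nat ->
    sum_f_R0 (fun j => f i j * p i j) n
      = (x i + /2) + sum_f_R0 (fun k => f k i * p k i) n }.

Lemma balanced_force_system n x y h :
  0 < h -> balanced n x y h -> exists f p, force_system n x y f p.
Proof.
intros Hh (f & p & f0 & supp & contact & eqm). exists f, p.
assert (rests : forall i j, f i j <> 0 -> rests_on n x y h i j).
{ intros i j Hij. apply Classical_Prop.NNPP. intros H. apply Hij, supp, H. }
assert (touch : forall i j, f i j <> 0 -> in_contact x y h i j (p i j)) by auto.
split; auto.
- intros i j Hij. destruct (rests i j Hij) as (? & ? & _); auto.
- intros i j Hij. destruct (rests i j Hij) as (Hi & _).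
  destruct (touch i j Hij) as (b & Hb & _). destruct i; [lia|]. apply Hb.
- intros i Hi. destruct (touch i O Hi) as (b & _ & Hb). apply Hb.
- intros i j Hj Hij. destruct (touch i j Hij) as (b & _ & Hb).
  destruct j; [easy|]. apply Hb.
- intros i j Hj Hij. destruct (rests i j Hij) as (_ & _ & _ & H).
  specialize (H Hj). lra.
- intros i Hi. apply eqm, Hi.
- intros i Hi. apply eqm, Hi.
Qed.

Definition listed (S : list nat) (i : nat) : R :=
  if in_dec Nat.eq_dec i (O :: S) then 1 else 0.

(* The forces acting on the blocks outside [S] from the blocks of [S] and the
   table, together with the weights of the blocks of [S]. *)
Definition load (n : nat) (x : nat -> R) (f p : nat -> nat -> R) (S : list nat)
    (phi : R -> R) : R :=
  sum_f_R0 (fun i => sum_f_R0 (fun j =>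
    (listed S j - listed S i) * (f i j * phi (p i j))) n) n
  + fold_right (fun i s => phi (x i + /2) + s) 0 S.

(** Possible sets of processed blocks, latest first: every block is supported only by the table and
    by blocks processed before it. *)
Inductive grounded (n : nat) (f : nat -> nat -> R) : list nat -> Prop :=
| grounded_nil : grounded n f nil
| grounded_cons i S : grounded n f S -> (1 <= i <= n)%nat -> ~ In i S ->
    (forall j, f i j <> 0 -> In j (O :: S)) -> grounded n f (i :: S).

Lemma grounded_in n f S i : grounded n f S -> In i S -> (1 <= i <= n)%nat.
Proof. induction 1; simpl; [easy|]. intros [<-|]; auto. Qed.

Lemma grounded_NoDup n f S : grounded n f S -> NoDup S.
Proof. induction 1; constructor; auto. Qed.

Lemma grounded_support n f S i j :
  grounded n f S -> In i S -> f i j <> 0 -> In j (O :: S).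
Proof.
induction 1 as [|k S _ IH _ _ Hk]; simpl; [easy|].
intros [<-|Hi] Hij.
- destruct (Hk j Hij); auto.
- destruct (IH Hi Hij); auto.
Qed.

Lemma listed_cons i S k :
  i <> O -> ~ In i S -> listed (i :: S) k = listed S k + (if Nat.eq_dec k i then 1 else 0).
Proof.
intros Hi HS; unfold listed.
destruct (in_dec Nat.eq_dec k (O :: i :: S)) as [H|H],
  (in_dec Nat.eq_dec k (O :: S)) as [H'|H'], (Nat.eq_dec k i) as [E|E];
  simpl in *; subst; try lra; exfalso; intuition.
Qed.

Lemma sum_delta g i n :
  (i <= n)%nat -> sum_f_R0 (fun k => (if Nat.eq_dec k i then 1 else 0) * g k) n = g i.
Proof.
assert (Z : forall n, (n < i)%nat ->
  sum_f_R0 (fun k => (if Nat.eq_dec k i then 1 else 0) * g k) n = 0).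
{ clear n; induction n as [|n IH]; intros H; cbn [sum_f_R0].
  - destruct (Nat.eq_dec 0 i); [lia|lra].
  - rewrite IH by lia. destruct (Nat.eq_dec (S n) i); [lia|lra]. }
induction n as [|n IH]; intros H; cbn [sum_f_R0].
- replace i with O by lia. destruct (Nat.eq_dec 0 0); [lra|easy].
- destruct (Nat.eq_dec (S n) i) as [<-|E].
  + rewrite Z by lia. lra.
  + rewrite IH by lia. lra.
Qed.

Lemma load_cons n x f p S i phi :
  (1 <= i <= n)%nat -> ~ In i S ->
  load n x f p (i :: S) phi = load n x f p S phi
    + sum_f_R0 (fun k => f k i * phi (p k i)) n
    - sum_f_R0 (fun j => f i j * phi (p i j)) n + phi (x i + /2).
Proof.
intros Hi HS. unfold load; simpl.
set (g := fun k j => f k j * phi (p k j)).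
set (d := fun k => if Nat.eq_dec k i then 1 else 0).
rewrite (sum_eq _ (fun k => sum_f_R0 (fun j => (listed S j - listed S k) * g k j) n
   + (g k i + d k * (- sum_f_R0 (g k) n)))).
- rewrite !sum_plus. unfold d at 1.
  rewrite (sum_delta (fun k => - sum_f_R0 (g k) n) i n) by lia.
  unfold g; ring.
- intros k Hk.
  rewrite (sum_eq _ (fun j => (listed S j - listed S k) * g k j
     + (d j * g k j + g k j * (- d k)))).
  + rewrite !sum_plus, <- scal_sum. unfold d at 1.
    rewrite (sum_delta (g k) i n) by lia. ring.
  + intros j Hj. rewrite !listed_cons by (lia || auto). unfold g, d. ring.
Qed.

(** All forces on block [i] act inside its unit interval, where testing against an affine function
    is exactly force balance and moment balance. *)
Lemma load_cons_affine n x y f p S i phi k b :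
  force_system n x y f p -> (1 <= i <= n)%nat -> ~ In i S ->
  (forall z, x i <= z <= x i + 1 -> phi z = k * z + b) ->
  load n x f p (i :: S) phi = load n x f p S phi.
Proof.
intros F Hi HS Hphi. rewrite load_cons by auto.
assert (E1 : sum_f_R0 (fun j => f i j * phi (p i j)) n
           = k * sum_f_R0 (fun j => f i j * p i j) n + b * sum_f_R0 (fun j => f i j) n).
{ rewrite !scal_sum, <- sum_plus. apply sum_eq; intros j _.
  destruct (Req_dec (f i j) 0) as [->|H]; [ring|].
  rewrite Hphi by (eapply force_above; eauto). ring. }
assert (E2 : sum_f_R0 (fun j => f j i * phi (p j i)) n
           = k * sum_f_R0 (fun j => f j i * p j i) n + b * sum_f_R0 (fun j => f j i) n).
{ rewrite !scal_sum, <- sum_plus. apply sum_eq; intros j _.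
  destruct (Req_dec (f j i) 0) as [->|H]; [ring|].
  rewrite Hphi by (eapply force_below; eauto; lia). ring. }
rewrite E1, E2, (moment_balance _ _ _ _ _ F i Hi), (force_balance _ _ _ _ _ F i Hi).
rewrite Hphi by lra. ring.
Qed.

Lemma load_comb n x f p S u v phi psi :
  load n x f p S (fun z => u * phi z + v * psi z) =
  u * load n x f p S phi + v * load n x f p S psi.
Proof.
unfold load.
assert (E : forall L, fold_right (fun i s => u * phi (x i + /2) + v * psi (x i + /2) + s) 0 L =
  u * fold_right (fun i s => phi (x i + /2) + s) 0 L +
  v * fold_right (fun i s => psi (x i + /2) + s) 0 L).
{ induction L as [|i L IH]; simpl; [ring|]. rewrite IH; ring. }
rewrite E, !Rmult_plus_distr_l, !scal_sum.
rewrite (sum_eq _ (fun i =>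
  sum_f_R0 (fun j => (listed S j - listed S i) * (f i j * phi (p i j))) n * u +
  sum_f_R0 (fun j => (listed S j - listed S i) * (f i j * psi (p i j))) n * v)).
- rewrite sum_plus. ring.
- intros i _. rewrite !(Rmult_comm (sum_f_R0 _ _)), !scal_sum, <- sum_plus.
  apply sum_eq; intros; ring.
Qed.

(** The load of a grounded set is a nonnegative measure: a coefficient [-1] would require a listed
    block supported by an unlisted one. *)
Lemma load_le n x y f p S phi psi :
  force_system n x y f p -> grounded n f S ->
  (forall z, phi z <= psi z) -> load n x f p S phi <= load n x f p S psi.
Proof.
intros F G H. apply Rplus_le_compat.
- apply sum_Rle; intros i _. apply sum_Rle; intros j _.
  destruct (Req_dec (f i j) 0) as [->|Hij]; [lra|].
  apply Rmult_le_compat_l; [|apply Rmult_le_compat_l; auto; eapply force_nonneg; eauto].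
  unfold listed. destruct (in_dec Nat.eq_dec i (O :: S)) as [Hi|], (in_dec Nat.eq_dec j (O :: S)) as [|Hj];
    try lra.
  destruct Hi as [<-|Hi].
  + apply (force_support _ _ _ _ _ F) in Hij. lia.
  + destruct Hj. eapply grounded_support; eauto.
- induction S as [|i S IH]; simpl; [lra|].
  inversion G; subst. apply Rplus_le_compat; auto.
Qed.

Lemma load_table_le n x y f p phi psi :
  force_system n x y f p -> (forall z, z <= 0 -> phi z <= psi z) ->
  load n x f p nil phi <= load n x f p nil psi.
Proof.
intros F H. apply Rplus_le_compat; [|simpl; lra].
apply sum_Rle; intros i _. apply sum_Rle; intros j _.
destruct (Req_dec (f i j) 0) as [->|Hij]; [lra|].
destruct (force_support _ _ _ _ _ F i j Hij) as [Hi _].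
unfold listed. destruct (in_dec Nat.eq_dec i (O :: nil)) as [[<-|[]]|_]; [lia|].
destruct (in_dec Nat.eq_dec j (O :: nil)) as [[<-|[]]|_]; [|lra].
apply Rmult_le_compat_l; [lra|]. apply Rmult_le_compat_l; [eapply force_nonneg; eauto|].
apply H. eapply force_table; eauto.
Qed.

Lemma load_affine n x y f p S k b :
  force_system n x y f p -> grounded n f S ->
  load n x f p S (fun z => k * z + b) = load n x f p nil (fun z => k * z + b).
Proof.
intros F; induction 1 as [|i S G IH Hi HS _]; [easy|].
rewrite <- IH. now apply load_cons_affine with (y := y) (k := k) (b := b).
Qed.

Lemma load_ramp_cons_outside n x y f p S i t :
  force_system n x y f p -> (1 <= i <= n)%nat -> ~ In i S ->
  t <= x i \/ x i + 1 <= t ->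
  load n x f p (i :: S) (ramp t) = load n x f p S (ramp t).
Proof.
intros F Hi HS [H|H].
- apply load_cons_affine with (y := y) (k := 1) (b := - t); auto.
  intros z Hz; unfold ramp; rewrite Rmax_right; lra.
- apply load_cons_affine with (y := y) (k := 0) (b := 0); auto.
  intros z Hz; unfold ramp; rewrite Rmax_left; lra.
Qed.

(** Processing a block fixes the potential at its two ends; in between, this convexity keeps it
    below the chord, which a sweep attains. *)
Lemma load_ramp_convex n x y f p S a t :
  force_system n x y f p -> grounded n f S -> a <= t <= a + 1 ->
  load n x f p S (ramp t) <= (a + 1 - t) * load n x f p S (ramp a)
                             + (t - a) * load n x f p S (ramp (a + 1)).
Proof.
intros F G H. rewrite <- load_comb. eapply load_le; eauto.
intros z. now apply ramp_chord.
Qed.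

Lemma load_ramp_nonneg n x y f p S t :
  force_system n x y f p -> grounded n f S -> 0 <= load n x f p S (ramp t).
Proof.
intros F G.
(* The zero function is written as a combination so that [load_comb] evaluates its load. *)
assert (Z : load n x f p S (fun z => 0 * ramp t z + 0 * ramp t z) = 0)
  by (rewrite load_comb; ring).
rewrite <- Z. eapply load_le; eauto.
intros z. pose proof (ramp_nonneg t z). lra.
Qed.

(** * Processing all blocks from bottom to top *)

Lemma min_element (y : nat -> R) (l : list nat) :
  l <> nil -> exists i, In i l /\ forall j, In j l -> y i <= y j.
Proof.
induction l as [|k l IH]; [easy|]. intros _.
destruct l as [|k' l].
- exists k. split; [now left|]. intros j [<-|[]]; lra.
- destruct IH as (i & Hi & min); [easy|].
  destruct (Rle_lt_dec (y k) (y i)) as [H|H].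
  + exists k. split; [now left|]. intros j [<-|Hj]; [lra|].
    specialize (min j Hj). lra.
  + exists i. split; [now right|]. intros j [<-|Hj]; [lra|auto].
Qed.

(** Greedy: a lowest unlisted block can be added, since whatever supports it is strictly lower and
    hence already listed. *)
Lemma grounded_full n x y f p :
  force_system n x y f p ->
  exists A, grounded n f A /\ length A = n /\ forall i, (1 <= i <= n)%nat -> In i A.
Proof.
intros F.
assert (partial : forall k, (k <= n)%nat -> exists S, grounded n f S /\ length S = k).
{ induction k as [|k IH]; intros Hk.
  { exists nil. split; [constructor|easy]. }
  destruct IH as (S & G & len); [lia|].
  set (rest := filter (fun i => if in_dec Nat.eq_dec i S then false else true) (seq 1 n)).
  assert (in_rest : forall i, In i rest <-> (1 <= i <= n)%nat /\ ~ In i S).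
  { intros i. unfold rest. rewrite filter_In, in_seq.
    destruct (in_dec Nat.eq_dec i S); intuition (easy || lia). }
  destruct (min_element y rest) as (i & Hi & min).
  { intros E.
    assert (incl (seq 1 n) S).
    { intros i Hi. apply in_seq in Hi. destruct (in_dec Nat.eq_dec i S); auto.
      exfalso. assert (In i rest) by (apply in_rest; split; auto; lia).
      rewrite E in *. easy. }
    pose proof (NoDup_incl_length (seq_NoDup n 1) H). rewrite length_seq in *. lia. }
  apply in_rest in Hi as [Hi HS].
  exists (i :: S). split; [|simpl; lia].
  constructor; auto. intros j Hij.
  destruct (Nat.eq_dec j 0) as [->|Hj]; [now left|right].
  destruct (in_dec Nat.eq_dec j S) as [|HjS]; auto. exfalso.
  assert (y i <= y j).
  { apply min, in_rest. split; auto. apply (force_support _ _ _ _ _ F) in Hij. lia. }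
  pose proof (force_upward _ _ _ _ _ F i j Hj Hij). lra. }
destruct (partial n) as (A & G & len); [lia|]. exists A; split; [|split]; auto.
intros i Hi.
apply (NoDup_length_incl (l := A) (l' := seq 1 n)).
- eapply grounded_NoDup; eauto.
- rewrite length_seq; lia.
- intros j Hj. apply (grounded_in _ _ _ _ G) in Hj. apply in_seq; lia.
- apply in_seq; lia.
Qed.

Lemma load_full n x f p A phi :
  (forall i, (1 <= i <= n)%nat -> In i A) ->
  load n x f p A phi = fold_right (fun i s => phi (x i + /2) + s) 0 A.
Proof.
intros full. unfold load.
assert (one : forall i, (i <= n)%nat -> listed A i = 1).
{ intros i Hi. unfold listed. destruct (in_dec Nat.eq_dec i (O :: A)) as [|H]; auto.
  destruct H. destruct i; [now left|right; apply full; lia]. }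
rewrite (sum_eq _ (fun _ => 0)).
- rewrite sum_cte. lra.
- intros i Hi. rewrite (sum_eq _ (fun _ => 0)); [rewrite sum_cte; lra|].
  intros j Hj. rewrite !one by auto. ring.
Qed.

(** * Comparison of the load with sweeps *)

Definition reaches (x : nat -> R) (r : R) (i : nat) : bool :=
  if Rlt_dec r (x i + 1) then true else false.

Definition swept (x : nat -> R) (r : R) (S : list nat) (m : list (R * R)) :=
  sweeps (map x (filter (reaches x r) S)) m.

(* Blocks not reaching beyond [r] only act on positions where the load is already
   dominated by the line through the starting point mass. *)
Lemma load_dominated n x y f p r c M S t :
  force_system n x y f p -> 0 <= M ->
  (forall S, grounded n f S ->
     load n x f p S (ramp r) <= M * (c - r) /\
     load n x f p S (ramp (r - 1)) <= M * (c - r + 1)) ->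
  (forall t, r <= t -> load n x f p nil (ramp t) <= M * ramp t c) ->
  grounded n f S -> r - 1 <= t ->
  load n x f p S (ramp t) <= wsum (ramp t) (swept x r S ((c, M) :: nil)).
Proof.
intros F HM line table G; revert t.
(* On [[r - 1, r]] convexity puts the load below the line [M (c - t)]; sweeps preserve mass and
   centre, so any swept mass has potential above that line. *)
assert (near : forall S l t, grounded n f S -> r - 1 <= t <= r ->
  load n x f p S (ramp t) <= wsum (ramp t) (sweeps l ((c, M) :: nil))).
{ clear S G. intros S l t G Ht.
  apply Rle_trans with (M * (c - t)).
  - destruct (line S G) as [H1 H2].
    pose proof (load_ramp_convex n x y f p S (r - 1) t F G) as C.
    replace (r - 1 + 1) with r in C by ring. specialize (C ltac:(lra)).
    apply Rle_trans with (1 := C).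
    replace (M * (c - t)) with ((r - t) * (M * (c - r + 1)) + (t - (r - 1)) * (M * (c - r))) by ring.
    apply Rplus_le_compat; apply Rmult_le_compat_l; lra.
  - replace (M * (c - t)) with (wsum (fun z => 1 * z + - t) (sweeps l ((c, M) :: nil)))
      by (rewrite sweeps_affine; simpl; ring).
    apply wsum_le.
    + apply nonneg_weights_sweeps. intros q [<-|[]]; auto.
    + intros z. unfold ramp. apply Rle_trans with (z - t); [lra|apply Rmax_r]. }
induction G as [|i S G IH Hi HS Hsup]; intros t Ht.
- destruct (Rle_lt_dec t r); [apply near; [constructor|lra]|].
  simpl. rewrite Rplus_0_r. apply table; lra.
- assert (G' : grounded n f (i :: S)) by (constructor; auto).
  unfold swept; simpl. unfold reaches at 1. destruct (Rlt_dec r (x i + 1)) as [Hr|Hr].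
  (* A block reaching beyond [r] starts beyond [r - 1], so both its ends lie in the range of the
     induction hypothesis. *)
  + simpl. fold (swept x r S ((c, M) :: nil)).
    destruct (Rle_lt_dec t (x i)); [|destruct (Rle_lt_dec (x i + 1) t)].
    * rewrite wsum_ramp_sweep_outside, (load_ramp_cons_outside n x y) by auto. auto.
    * rewrite wsum_ramp_sweep_outside, (load_ramp_cons_outside n x y) by auto. auto.
    * rewrite wsum_ramp_sweep_inside by lra.
      apply Rle_trans with (1 := load_ramp_convex n x y f p (i :: S) (x i) t F G' ltac:(lra)).
      rewrite !(load_ramp_cons_outside n x y f p S i) by (auto; lra).
      apply Rplus_le_compat; apply Rmult_le_compat_l; try lra; apply IH; lra.
  + destruct (Rle_lt_dec t r); [apply near; auto; lra|].
    rewrite (load_ramp_cons_outside n x y) by (auto; lra). now apply IH.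
Qed.

(** A Markov bound: each block reaching beyond [r] has its unit mass at a centre beyond
    [r - 1/2]. *)
Lemma full_load_count n x f p A r t :
  (forall i, (1 <= i <= n)%nat -> In i A) ->
  INR (length (filter (reaches x r) A)) * (r - /2 - t) <= load n x f p A (ramp t).
Proof.
intros full. rewrite load_full by auto. clear full.
induction A as [|i A IH]; simpl; [lra|].
unfold reaches at 1. destruct (Rlt_dec r (x i + 1)) as [H|H].
- simpl length. rewrite S_INR.
  assert (r - /2 - t <= ramp t (x i + /2)).
  { apply Rle_trans with (x i + /2 - t); [lra|apply Rmax_r]. }
  lra.
- pose proof (ramp_nonneg t (x i + /2)). lra.
Qed.

(** * Induction on the scale [L] *)

(** The invariant says that, seen from [r] on, the load behaves like mass [L^3] at [c] and at most
    [L^3] blocks are involved. [k] bounds the number of halvings until [L < 1]. *)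
Lemma overhang_induction n x y f p A k :
  force_system n x y f p -> grounded n f A ->
  (forall i, (1 <= i <= n)%nat -> In i A) ->
  forall L r c, 0 < L -> L < 2 ^ k -> 0 <= c ->
  (forall S, grounded n f S ->
     load n x f p S (ramp r) <= L ^ 3 * (c - r) /\
     load n x f p S (ramp (r - 1)) <= L ^ 3 * (c - r + 1)) ->
  (forall t, r <= t -> load n x f p nil (ramp t) <= L ^ 3 * ramp t c) ->
  INR (length (filter (reaches x r) A)) <= L ^ 3 ->
  forall i, (1 <= i <= n)%nat -> x i + 1 <= c + 6 * L.
Proof.
intros F GA full.
(* For [L < 1] the count is below one, so no block reaches beyond [r]; and [r <= c] because the load
   of a ramp is nonnegative. *)
assert (base : forall L r c, 0 < L < 1 ->
  load n x f p A (ramp r) <= L ^ 3 * (c - r) ->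
  INR (length (filter (reaches x r) A)) <= L ^ 3 ->
  forall i, (1 <= i <= n)%nat -> x i + 1 <= c + 6 * L).
{ intros L r c HL line count i Hi.
  assert (HL3 : 0 < L ^ 3) by (apply pow_lt; lra).
  assert (L ^ 3 < 1) by (simpl; nra).
  assert (r <= c).
  { pose proof (load_ramp_nonneg n x y f p A r F GA). nra. }
  destruct (Rlt_dec r (x i + 1)) as [Hr|]; [exfalso|lra].
  assert (In i (filter (reaches x r) A)) as Hin.
  { apply filter_In; split; auto. unfold reaches. now destruct (Rlt_dec r (x i + 1)). }
  destruct (filter (reaches x r) A); [easy|].
  simpl length in count. rewrite S_INR in count. pose proof (pos_INR (length l)). lra. }
induction k as [|k IH]; intros L r c HL Lk Hc line table count i Hi.
{ simpl in Lk. apply (base L r c); auto. now apply line. }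
destruct (Rlt_le_dec L 1) as [L1|L1]; [apply (base L r c); auto; now apply line|].
assert (HL3 : 0 < L ^ 3) by (apply pow_lt; lra).
assert (HL4 : 0 < L ^ 4) by (apply pow_lt; lra).
assert (rc : r <= c).
{ pose proof (load_ramp_nonneg n x y f p A r F GA). destruct (line A GA). nra. }
assert (far : forall S s, grounded n f S -> 0 < s ->
          load n x f p S (ramp (c + s)) <= L ^ 5 / (10 * s)).
{ intros S s G Hs.
  apply Rle_trans with (wsum (ramp (c + s)) (swept x r S ((c, L ^ 3) :: nil))).
  - apply (load_dominated n x y); auto; lra.
  - apply wsum_ramp_sweeps_point; auto. rewrite length_map.
    apply Rle_trans with (2 := count), le_INR.
    apply NoDup_incl_length.
    + apply NoDup_filter. eapply grounded_NoDup; eauto.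
    + intros j Hj. apply filter_In in Hj as [Hj Hr]. apply filter_In; split; auto.
      apply full. eapply grounded_in; eauto. }
(* The extra [1/2] offsets the distance from a block's right end to its centre. The Markov bound
   taken halfway, at [c + 9/10 L], leaves at most [10/81 L^3 < L^3 / 8] blocks. *)
set (r' := c + 9 / 5 * L + /2).
assert (goal : x i + 1 <= (c + 3 * L) + 6 * (L / 2)).
{ apply (IH (L / 2) r' (c + 3 * L)); auto; unfold r'.
  - lra.
  - simpl in Lk; lra.
  - lra.
  - intros S G. split.
    + replace (c + 9 / 5 * L + / 2) with (c + (9 / 5 * L + / 2)) by ring.
      apply Rle_trans with (1 := far S (9 / 5 * L + /2) G ltac:(lra)).
      apply Rle_trans with (L ^ 5 / (18 * L)).
      * apply Rmult_le_compat_l; [apply pow_le; lra|]. apply Rinv_le_contravar; lra.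
      * replace (L ^ 5 / (18 * L)) with (L ^ 3 * (L / 18)) by (field; lra).
        replace ((L / 2) ^ 3 * (c + 3 * L - (c + (9 / 5 * L + / 2)))) with
          (L ^ 3 * ((6 / 5 * L - / 2) / 8)) by field.
        apply Rmult_le_compat_l; lra.
    + replace (c + 9 / 5 * L + / 2 - 1) with (c + (9 / 5 * L - / 2)) by field.
      (* [L >= 1] gives [9/5 L - 1/2 >= L], so the unit window left of the new threshold remains at
         distance at least [L] from [c]. *)
      apply Rle_trans with (1 := far S (9 / 5 * L - /2) G ltac:(lra)).
      apply Rle_trans with (L ^ 5 / (10 * L)).
      * apply Rmult_le_compat_l; [apply pow_le; lra|]. apply Rinv_le_contravar; lra.
      * replace (L ^ 5 / (10 * L)) with (L ^ 3 * (L / 10)) by (field; lra).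
        replace ((L / 2) ^ 3 * (c + 3 * L - (c + 9 / 5 * L + / 2) + 1)) with
          (L ^ 3 * ((6 / 5 * L + / 2) / 8)) by field.
        apply Rmult_le_compat_l; lra.
  (* Here [t > 0], so the ramp vanishes on the whole table and the initial load of it is zero. *)
  - intros t Ht.
    apply Rle_trans with (load n x f p nil (fun z => 0 * ramp t z + 0 * ramp t z)).
    + apply (load_table_le n x y); auto. intros z Hz.
      unfold ramp at 1; rewrite Rmax_left; lra.
    + rewrite load_comb. pose proof (ramp_nonneg t (c + 3 * L)).
      assert (0 < (L / 2) ^ 3) by (apply pow_lt; lra). nra.
  - pose proof (full_load_count n x f p A r' (c + 9 / 10 * L) full) as N.
    pose proof (far A (9 / 10 * L) GA ltac:(lra)) as B.
    fold r'. set (N' := INR (length (filter (reaches x r') A))) in *.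
    replace (L ^ 5 / (10 * (9 / 10 * L))) with (L ^ 3 / 9 * L) in B by (field; lra).
    unfold r' in N. replace (c + 9 / 5 * L + / 2 - / 2 - (c + 9 / 10 * L)) with (9 / 10 * L) in N by field.
    replace ((L / 2) ^ 3) with (L ^ 3 / 8) by field.
    apply (Rmult_le_reg_r L); auto.
    assert (0 < L ^ 3 * L) by (apply Rmult_lt_0_compat; lra). lra. }
lra.
Qed.

(** * Starting data for the induction *)

Lemma exists_lower_bound (x : nat -> R) n :
  exists r, r <= 0 /\ forall i, (i <= n)%nat -> r <= x i.
Proof.
induction n as [|n (r & Hr & H)].
- exists (Rmin 0 (x O)). split; [apply Rmin_l|].
  intros i Hi. replace i with O by lia. apply Rmin_r.
- exists (Rmin r (x (S n))). split; [apply Rle_trans with r; auto; apply Rmin_l|].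
  intros i Hi. destruct (Nat.eq_dec i (S n)) as [->|]; [apply Rmin_r|].
  apply Rle_trans with r; [apply Rmin_l|apply H; lia].
Qed.

Lemma load_ramp_leftmost n x y f p S r :
  force_system n x y f p -> grounded n f S ->
  (forall i, (1 <= i <= n)%nat -> r <= x i) ->
  load n x f p S (ramp r) = load n x f p nil (ramp r).
Proof.
intros F G Hr; induction G as [|i S G IH Hi HS _]; [easy|].
rewrite <- IH. apply (load_ramp_cons_outside n x y); auto.
Qed.

(** The table carries total force [n], found by following a constant test function through the whole
    process; moving that mass right to [0] only raises ramps. *)
Lemma load_table_ramp n x y f p t :
  force_system n x y f p -> load n x f p nil (ramp t) <= INR n * ramp t 0.
Proof.
intros F. destruct (grounded_full n x y f p F) as (A & G & len & full).
apply Rle_trans with (load n x f p nil (fun z => 0 * z + ramp t 0)).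
- apply (load_table_le n x y); auto. intros z Hz. unfold ramp.
  rewrite Rmult_0_l, Rplus_0_l. apply Rle_max_compat_l; lra.
- right. rewrite <- (load_affine n x y f p A) by auto.
  rewrite load_full, <- len by auto. clear.
  induction A as [|i A IH]; simpl length; simpl fold_right; [simpl; lra|].
  rewrite S_INR, IH. ring.
Qed.

Theorem mainTheorem1 (n : nat) (h : R) (x y : nat -> R) :
  (1 <= n)%nat -> 0 < h ->
  valid_stack n x y h -> balanced n x y h ->
  forall i, (1 <= i <= n)%nat -> x i + 1 <= 6 * Rpower (INR n) (1/3).
Proof.
intros Hn Hh _ bal i Hi.
destruct (balanced_force_system n x y h Hh bal) as (f & p & F).
destruct (grounded_full n x y f p F) as (A & G & len & full).
destruct (exists_lower_bound x n) as (r & r0 & Hr).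
set (L := Rpower (INR n) (1 / 3)).
assert (n0 : 0 < INR n) by (apply lt_0_INR; lia).
assert (HL : 0 < L) by apply exp_pos.
assert (L3 : L ^ 3 = INR n).
{ rewrite <- Rpower_pow by auto. unfold L. rewrite Rpower_mult.
  replace (1 / 3 * INR 3) with 1 by (simpl; field). now apply Rpower_1. }
destruct (INR_unbounded L) as (k & Hk).
replace (6 * L) with (0 + 6 * L) by ring.
(* Start with mass [n = L^3] at [c = 0] and [r] left of every block: potentials at or left of [r]
   never change, and there are only [n] blocks to count. *)
apply (overhang_induction n x y f p A k) with (r := r); auto.
- apply Rlt_le_trans with (1 := Hk). clear.
  induction k as [|k IH]; [simpl; lra|]. rewrite S_INR. simpl.
  assert (1 <= 2 ^ k) by (apply pow_R1_Rle; lra). lra.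
- lra.
- assert (line : forall S t, grounded n f S -> t <= r ->
            load n x f p S (ramp t) <= L ^ 3 * (0 - t)).
  { intros S t GS Ht. rewrite (load_ramp_leftmost n x y); auto.
    - rewrite L3. apply Rle_trans with (1 := load_table_ramp n x y f p t F).
      unfold ramp. rewrite Rmax_right; lra.
    - intros j Hj. apply Rle_trans with r; auto. apply Hr; lia. }
  intros S GS. split; [apply line; auto; lra|].
  replace (0 - r + 1) with (0 - (r - 1)) by ring. apply line; auto; lra.
- intros t _. rewrite L3. now apply (load_table_ramp n x y).
- rewrite L3, <- len. apply le_INR, filter_length_le.
Qed.
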